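(* Let $(x_n),(y_n)$ be $\mathcal{P}$-null sequences in Schreier's space $S$. Then: (a) the set $\{x_n\otimes y_n : n\in\mathbb{N}\}$ is a Banach-Saks set in $S\otimes_\pi S$; (b) the sequence $(x_n\otimes y_n)$ is $\mathcal{P}$-null in $S\otimes_\pi S$.
   Context: A finite subset $A=\{n_1<\cdots<n_k\}$ of $\mathbb{N}=\{1,2,\dots\}$ is admissible if $k\le n_1$. Schreier's space $S$ is the completion of the space $c_{00}$ of finitely supported scalar sequences under the norm $\|x\|_S=\sup\{\sum_{j\in A}|x_j| : A\subset\mathbb{N}\text{ admissible}\}$. $S\otimes_\pi S$ denotes the (completed) projective tensor product. For a Banach space $E$, ${\mathcal P}({}^kE)$ is the space of scalar-valued continuous $k$-homogeneous polynomials on $E$. A sequence $(x_n)\subset E$ is $\mathcal{P}$-null if $P(x_n)\to 0$ for every $k\in\mathbb{N}$ and every $P\in{\mathcal P}({}^kE)$. A subset $A$ of a Banach space is a Banach-Saks set if every sequence in $A$ has a subsequence whose arithmetic means converge in norm. *)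

(* Defs.v *)
From HB Require Import structures.
From mathcomp Require Import all_boot all_order all_algebra finmap.
From mathcomp Require Import sesquilinear complex.
From mathcomp Require Import all_classical all_reals all_analysis.

Set Implicit Arguments.
Unset Strict Implicit.
Unset Printing Implicit Defensive.

Import Order.TTheory GRing.Theory Num.Theory.
Import numFieldNormedType.Exports.

Local Open Scope classical_set_scope.
Local Open Scope ring_scope.

(* Throughout, K is the scalar field; only K = R and K = R[i], for R a
   realType, are intended. Norms then take their values in K itself, ordered
   (partially when K = R[i]) by: x <= y iff y - x is a nonnegative real. For
   sets of nonnegative reals seen in R[i], suprema and infima in this order are
   the real ones. *)

Definition finitely_supported (K : numFieldType) : {pred nat -> K} :=
  [pred x : nat -> K | `[< finite_set [set n | x n != 0] >]].

Lemma finitely_supported_submod (K : numFieldType) :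
  submod_closed (@finitely_supported K).
Proof.
split=> [|a x y /asboolP fx /asboolP fy]; apply/asboolP.
  by rewrite (_ : [set n | _] = set0)// -subset0 => n /=; rewrite eqxx.
apply: (@sub_finite_set _ _ ([set n | x n != 0] `|` [set n | y n != 0])).
  move=> n /= axy; have [xn0|] := eqVneq (x n) 0; last by left.
  right; apply: contra_neq axy => yn0.
  by rewrite (_ : (a *: x + y) n = a * x n + y n)// xn0 yn0 mulr0 addr0.
by rewrite finite_setU.
Qed.

HB.instance Definition _ (K : numFieldType) :=
  GRing.isSubmodClosed.Build K (nat -> K) (@finitely_supported K)
    (@finitely_supported_submod K).

Record c00 (K : numFieldType) := C00 {
  c00_val :> nat -> K ;
  _ : c00_val \in @finitely_supported K }.

HB.instance Definition _ (K : numFieldType) := [isSub for @c00_val K].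
HB.instance Definition _ (K : numFieldType) := [Choice of c00 K by <:].
HB.instance Definition _ (K : numFieldType) :=
  [SubChoice_isSubLmodule of c00 K by <:].

(* Sequences are indexed from 0: the index n : nat stands for the positive
   integer n.+1, whence the successor below. *)
Definition admissible (A : {fset nat}) :=
  forall n, n \in A -> (#|` A| <= n.+1)%N.

Definition schreier_norm (K : numFieldType) (x : c00 K) : K :=
  supremum 0 [set \sum_(n <- A) `|x n| | A in admissible].

(* A completion is determined up to linear isometry by this property, so it is
   specified rather than constructed. *)
Definition is_completion (K : numFieldType) (V : lmodType K) (p : V -> K)
    (E : completeNormedModType K) (j : {linear V -> E}) :=
  (forall v, `|j v| = p v) /\ dense (range j).

(* The universal property of the algebraic tensor product; the completed
   projective tensor product of E and F is a completion of it for
   projective_norm below. *)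
Definition is_tensor_product (K : numFieldType) (U V T : lmodType K)
    (tau : {bilinear U -> V -> T}) :=
  forall (W : lmodType K) (B : {bilinear U -> V -> W}),
    (exists L : {linear T -> W}, forall u v, L (tau u v) = B u v) /\
    (forall L L' : {linear T -> W},
      (forall u v, L (tau u v) = L' (tau u v)) -> L =1 L').

Definition projective_norm (K : numFieldType) (E F : normedModType K)
    (T : lmodType K) (tau : {bilinear E -> F -> T}) (t : T) : K :=
  infimum 0 [set \sum_(uv <- s) `|uv.1| * `|uv.2| |
             s in [set s : seq (E * F) | t = \sum_(uv <- s) tau uv.1 uv.2]].

(* dfwith f i x is f with its i-th entry replaced by x. *)
Definition multilinear_form (K : numFieldType) (E : lmodType K) (k : nat)
    (A : ('I_k -> E) -> K) :=
  forall (f : 'I_k -> E) (i : 'I_k), scalar (fun x : E => A (dfwith f i x)).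

Definition continuous_homogeneous_polynomial (K : numFieldType)
    (E : normedModType K) (k : nat) (P : E -> K) :=
  (exists2 A : ('I_k -> E) -> K,
     multilinear_form A & forall x, P x = A (fun=> x)) /\
  continuous P.

Definition P_null (K : numFieldType) (E : normedModType K) (x : nat -> E) :=
  forall (k : nat) (P : E -> K), (0 < k)%N ->
    continuous_homogeneous_polynomial k P -> P (x n) @[n --> \oo] --> (0 : K).

Definition Banach_Saks_set (K : numFieldType) (E : normedModType K)
    (A : set E) :=
  forall u : nat -> E, (forall n, A (u n)) ->
    exists2 f : nat -> nat, {homo f : m n / (m < n)%N} &
      exists l : E, n.+1%:R^-1 *: (\sum_(i < n.+1) u (f i)) @[n --> \oo] --> l.

(* Main.v *)
(* A P-null sequence in S is null for every continuous bilinear form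
   restricted to the diagonal. Gliding-hump forms
   B(x, y) = sum_m psi_m(x) psi_m(y) then show that it is bounded (psi_m
   nearly norming and of norm at most 2^-m) and tends to 0 in sup norm (psi_m
   distinct coordinates: S embeds in weak l1, hence in l2). Such a sequence has
   a subsequence dominated by the unit vector basis of c0, since an admissible
   set starting below L has at most L elements. Choosing the subsequence for x
   and y simultaneously and averaging (sum +-x_i) (x) (sum +-y_i) over the
   signs, x_i (x) y_i has uniformly bounded sums over finite sets. Therefore
   its arithmetic means tend to 0, and so does its image under any polynomial,
   as the latter is additive up to small errors along sparse subsequences. *)
Require Import Defs.
From HB Require Import structures.
From mathcomp Require Import all_boot all_order all_algebra finmap.
From mathcomp Require Import sesquilinear complex.
From mathcomp Require Import all_classical all_reals all_analysis.
From mathcomp Require Import zify ring.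

Set Implicit Arguments.
Unset Strict Implicit.
Unset Printing Implicit Defensive.

Import Order.TTheory GRing.Theory Num.Theory.
Import numFieldNormedType.Exports.

Local Open Scope classical_set_scope.
Local Open Scope ring_scope.

(** * Scalars: the real and complex fields *)

(* The only properties of R and R[i] that the argument uses. *)
Definition scalar_like (K : numFieldType) : Prop :=
  [/\ forall x : K, exists n : nat, `|x| < n%:R,
      forall A : set K, A !=set0 -> (forall a, A a -> 0 <= a) ->
        exists m, (forall a, A a -> m <= a) /\
          (forall b, (forall a, A a -> b <= a) -> b <= m)
    & forall (u : nat -> K) (M : K), (forall n, `|u n| <= M) ->
        exists2 f : nat -> nat, {homo f : m n / (m < n)%N} &
          exists a : K, u (f n) @[n --> \oo] --> a].

Lemma homo_ltn_ge (f : nat -> nat) :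
  {homo f : m n / (m < n)%N} -> forall n, (n <= f n)%N.
Proof. by move=> hf; elim=> // n ih; apply: leq_ltn_trans ih (hf _ _ _). Qed.

Lemma homo_ltn_inj (f : nat -> nat) :
  {homo f : m n / (m < n)%N} -> injective f.
Proof.
by move=> hf m n e; case: (ltngtP m n) => // /hf; rewrite e ltnn.
Qed.

Lemma homo_ltn_cvg (f : nat -> nat) :
  {homo f : m n / (m < n)%N} -> f n @[n --> \oo] --> \oo.
Proof.
move=> hf A [N _ NA]; exists N => // n /= Nn; apply: NA => /=.
exact: leq_trans Nn (homo_ltn_ge hf n).
Qed.

Lemma scalar_like_real (R : realType) : scalar_like R.
Proof.
split.
- by move=> x; exists (Num.truncn `|x|).+1; rewrite truncnS_gt.
- move=> A A0 Age; exists (inf A); split=> [a Aa|b bA].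
    by apply: ge_inf => //; exists 0 => a' /Age.
  by apply: lb_le_inf => // a /bA.
- move=> u M uM.
  have [|f fi /cvg_ex[a fa]] := @bolzano_weierstrass R u.
    exists M; split; first by rewrite num_real.
    by move=> x Mx n _ /=; rewrite (le_trans (uM n))// ltW.
  by exists f; [by move=> m n mn; exact: etrans (leW_mono fi m n) mn|exists a].
Qed.

Lemma sqrtrD_le_norm (R : rcfType) (x y : R) :
  Num.sqrt (x ^+ 2 + y ^+ 2) <= `|x| + `|y|.
Proof.
rewrite -(ger0_norm (addr_ge0 (normr_ge0 x) (normr_ge0 y))) -sqrtr_sqr.
rewrite ler_wsqrtr// sqrrD !real_normK ?num_real// addrAC lerDl.
by rewrite mulrn_wge0// mulr_ge0.
Qed.

Lemma cvg_complex (R : realType) (u : nat -> (R[i] : numFieldType)) (a b : R) :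
  complex.Re (u n) @[n --> \oo] --> a -> complex.Im (u n) @[n --> \oo] --> b ->
  u n @[n --> \oo] --> ((a +i* b)%C : (R[i] : numFieldType)).
Proof.
move=> /cvgrPdist_lt ua /cvgrPdist_lt ub; apply/cvgrPdist_lt => e.
case: e => e ei; rewrite ltcE /= => /andP[/eqP-> e0].
have e20 : 0 < e / 2 by rewrite divr_gt0.
near=> n.
have : `|b - complex.Im (u n)| < e / 2 by near: n; exact: ub.
have : `|a - complex.Re (u n)| < e / 2 by near: n; exact: ua.
case: (u n) => r s /= h1 h2; rewrite normc_def /= ltcR.
apply: le_lt_trans (sqrtrD_le_norm _ _) _.
by rewrite [e]splitr ltrD.
Unshelve. all: by end_near. Qed.

(** Elements comparable with a real are real up to the same imaginary part, so infima reduce to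
    those of real parts. For Bolzano-Weierstrass, the real parts are made to converge first, then
    the imaginary parts along that subsequence. *)
Lemma scalar_like_complex (R : realType) : scalar_like (R[i] : numFieldType).
Proof.
split.
- case=> r s; exists (Num.truncn (`|r| + `|s|)).+1; rewrite normc_def /=.
  rewrite -(rmorph_nat (real_complex R)) ltcR.
  exact: le_lt_trans (sqrtrD_le_norm _ _) (truncnS_gt _).
- move=> A [a0 Aa0] Age.
  have AR a : A a -> a = (complex.Re a)%:C%C.
    by move=> /Age; case: a => r s; rewrite lecE /= => /andP[/eqP-> _].
  have Ace : has_inf [set complex.Re a | a in A].
    split; first by exists (complex.Re a0), a0.
    by exists 0 => _ [a /Age + <-]; rewrite lecE => /andP[].
  exists (inf [set complex.Re a | a in A])%:C%C; split=> [a Aa|b bA].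
    by rewrite (AR _ Aa) lecR; apply: ge_inf; [exact: Ace.2|exists a].
  have := bA _ Aa0; rewrite (AR _ Aa0); case: b bA => r s bA.
  rewrite !lecE /= => /andP[/eqP<- _]; rewrite eqxx /=.
  apply: lb_le_inf; first exact: Ace.1.
  by move=> _ [a /bA + <-]; rewrite lecE => /andP[].
- move=> u M uM.
  have uR n : `|complex.Re (u n)| <= complex.Re M /\
              `|complex.Im (u n)| <= complex.Re M.
    have := uM n; case: (u n) => r s; rewrite normc_def lecE /= => /andP[_ rsM].
    by split; apply: le_trans rsM; rewrite -sqrtr_sqr ler_wsqrtr// ?lerDl ?lerDr
      sqr_ge0.
  have [_ _ bw] := scalar_like_real R.
  have [f fi [a fa]] := bw _ _ (fun n => (uR n).1).
  have [g gi [b gb]] := bw _ _ (fun n => (uR (f n)).2).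
  exists (f \o g) => [m n mn|]; first exact/fi/gi.
  exists (a +i* b)%C; apply: cvg_complex => //=.
  exact: cvg_comp (homo_ltn_cvg gi) fa.
Qed.

(** * Choice of sparse subsequences *)

(** Dependent choice with full memory: [mkseq s m] lists the terms chosen before step [m]. *)
Lemma history_choice (X : Type) (P : seq X -> X -> Prop) :
  (forall h, exists x, P h x) -> exists s : nat -> X, forall m, P (mkseq s m) (s m).
Proof.
move=> /choice[F PF]; pose H m := iter m (fun h => rcons h (F h)) [::].
exists (F \o H) => m; rewrite (_ : mkseq _ m = H m); first exact: PF.
by elim: m => // m ih; rewrite mkseqS ih.
Qed.

Lemma subseq_choice (P : seq nat -> nat -> Prop) :
  (forall h N, exists2 n, (N <= n)%N & P h n) ->
  exists2 f : nat -> nat, {homo f : m n / (m < n)%N} &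
    forall m, P (mkseq f m) (f m).
Proof.
move=> hP; have [h|f hf] := @history_choice _
    (fun h n => (forall i, i \in h -> (i < n)%N) /\ P h n).
  have [n hn Pn] := hP h (\max_(i <- h) i).+1; exists n; split=> // i ih.
  by apply: leq_trans hn; rewrite ltnS; exact: leq_bigmax_seq.
exists f => [m n mn|m]; last exact: (hf m).2.
by apply: (hf n).1; apply/mapP; exists m; rewrite ?mem_iota.
Qed.

Lemma frequently_subseq (P : nat -> Prop) :
  (forall N, exists2 n, (N <= n)%N & P n) ->
  exists2 f : nat -> nat, {homo f : m n / (m < n)%N} & forall m, P (f m).
Proof. by move=> hP; apply: (@subseq_choice (fun=> P)) => _; exact: hP. Qed.

(** * Null sequences *)

Section null_sequences.
Context (K : numFieldType) (E : normedModType K).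
Implicit Types u v : nat -> E.

Lemma cvg0P u : u n @[n --> \oo] --> 0 <->
  forall e : K, 0 < e -> exists N, forall n, (N <= n)%N -> `|u n| < e.
Proof.
split=> [/cvgr0Pnorm_lt h e e0|h].
  by have [N _ hN] := h e e0; exists N => n Nn; exact: hN.
apply/cvgr0Pnorm_lt => e e0; have [N hN] := h e e0.
by exists N => // n /= Nn; exact: hN.
Qed.

Lemma not_cvg0P u : ~ u n @[n --> \oo] --> 0 ->
  exists2 e : K, 0 < e & forall N, exists2 n, (N <= n)%N & e <= `|u n|.
Proof.
move=> nu; apply: contrapT => h; apply/nu/cvg0P => e e0.
apply: contrapT => /forallNP he; apply: h; exists e => // N.
apply: contrapT => hN; apply: (he N) => n Nn.
rewrite real_ltNge ?normr_real ?gtr0_real//; apply/negP => eu.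
by apply: hN; exists n.
Qed.

End null_sequences.

(** * Polynomials and their finite differences *)

Section polynomials.
Context (K : numFieldType).

(* Frechet's notion of a (not necessarily homogeneous) polynomial of degree at
   most k; unlike the homogeneous ones, it is stable under differences. *)
Fixpoint degree_le (E : zmodType) k (f : E -> K) : Prop :=
  if k is l.+1 then forall x, degree_le l (fun h => f (x + h) - f h)
  else forall x, f x = f 0.

Lemma degree_leD (E : zmodType) k (f g : E -> K) :
  degree_le k f -> degree_le k g -> degree_le k (fun x => f x + g x).
Proof.
elim: k f g => [|k ih] f g hf hg x; first by rewrite (hf x) (hg x).
rewrite (_ : (fun _ => _) =
  (fun h => (f (x + h) - f h) + (g (x + h) - g h))); first exact: ih.
by apply/funext => h; rewrite opprD addrACA.
Qed.

Lemma degree_le_cst (E : zmodType) k (c : K) : degree_le k (fun _ : E => c).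
Proof.
by elim: k c => [//|k ih] c x; exact: ih.
Qed.

Lemma degree_le_sum (E : zmodType) k (I : Type) (s : seq I) (f : I -> E -> K) :
  (forall i, degree_le k (f i)) -> degree_le k (fun x => \sum_(i <- s) f i x).
Proof.
move=> hf; elim: s => [|i s ih].
  rewrite (_ : (fun _ => _) = fun=> 0); first exact: degree_le_cst.
  by apply/funext => x; rewrite big_nil.
rewrite (_ : (fun _ => _) = fun x => f i x + \sum_(i <- s) f i x).
  exact: degree_leD.
by apply/funext => x; rewrite big_cons.
Qed.

Section multilinear.
Context (E : lmodType K) (k : nat) (A : ('I_k -> E) -> K).
Hypothesis Alin : multilinear_form A.

Lemma multilinear_formD f i u v :
  A (dfwith f i (u + v)) = A (dfwith f i u) + A (dfwith f i v).
Proof. by have := Alin f i 1 u v; rewrite scale1r mul1r. Qed.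

Lemma multilinear_form0 f i : A (dfwith f i 0) = 0.
Proof.
by apply: (@addrI _ (A (dfwith f i 0))); rewrite -multilinear_formD !addr0.
Qed.

Lemma multilinear_formZ f i a u : A (dfwith f i (a *: u)) = a * A (dfwith f i u).
Proof.
by have := Alin f i a u 0; rewrite addr0 multilinear_form0 addr0.
Qed.

Lemma dfwith_id (f : 'I_k -> E) i : dfwith f i (f i) = f.
Proof. by apply/funext => j; case: dfwithP. Qed.

Lemma multilinear_form_diagZ a x : A (fun=> a *: x) = a ^+ k * A (fun=> x).
Proof.
suff h s : (s <= k)%N ->
    A (fun i : 'I_k => if (i < s)%N then a *: x else x) = a ^+ s * A (fun=> x).
  by rewrite -h//; congr A; apply/funext => i; rewrite ltn_ord.
elim: s => [_|s ih sk]; first by rewrite mul1r.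
rewrite exprS -mulrA -ih 1?ltnW//.
set f := (X in _ * A X); pose i := Ordinal sk.
have fi : f i = x by rewrite /f ltnn.
rewrite -(dfwith_id f i) fi -multilinear_formZ; congr A; apply/funext => j.
case: dfwithP => [|j' ij']; first by rewrite ltnSn.
rewrite /f ltnS leq_eqVlt (_ : _ == _ = false)//.
by apply/negP => /eqP e; case/eqP: ij'; exact/val_inj/esym.
Qed.

(** The increment telescopes over the slots: passing from [g s] to [g s.+1] adds [x] in slot [s]; by
    linearity the difference has [x] alone there, so that one slot fewer depends on [h]. *)
Lemma degree_le_multilinear n (J : {set 'I_k}) (c : 'I_k -> E) : (#|J| <= n)%N ->
  degree_le n (fun h => A (fun i => c i + (if i \in J then h else 0))).
Proof.
elim: n J c => [|n ih] J c Jn.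
  move=> x; congr A; apply/funext => i.
  by move: Jn; rewrite leqn0 cards_eq0 => /eqP->; rewrite inE.
move=> x; pose g s h := A (fun i => c i + (if i \in J then h else 0) +
  (if (i \in J) && (i < s)%N then x else 0)).
rewrite (_ : (fun _ => _) = fun h => \sum_(s <- enum 'I_k) (g s.+1 h - g s h)).
  apply: degree_le_sum => s.
  have [sJ|sJ] := boolP (s \in J); last first.
    rewrite (_ : (fun _ => _) = fun=> 0); first exact: degree_le_cst.
    apply/funext => h; apply/eqP; rewrite subr_eq0; apply/eqP.
    congr A; apply/funext => i; congr (_ + _).
    have [iJ|//] := boolP (i \in J); rewrite ltnS leq_eqVlt.
    by rewrite (_ : _ == _ = false)//; apply: contraNF sJ => /eqP/val_inj<-.
  (* Slot [s] is frozen at [x]; the slots of [J] before it already carry [x] besides [h], those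
     after it do not. *)
  pose c' i := if i == s then x else
    c i + (if (i \in J) && (i < s)%N then x else 0).
  rewrite (_ : (fun _ => _) =
      fun h => A (fun i => c' i + (if i \in J :\ s then h else 0))).
    by apply: ih; move: Jn; rewrite (cardsD1 s) sJ.
  apply/funext => h; apply/eqP; rewrite subr_eq; apply/eqP.
  pose F i := c i + (if i \in J then h else 0) +
     (if (i \in J) && (i < s)%N then x else 0).
  have Fs : F s = c s + h by rewrite /F sJ ltnn addr0.
  have gs : g s h = A (dfwith F s (c s + h)) by rewrite -Fs dfwith_id.
  transitivity (A (dfwith F s (x + (c s + h)))).
    congr A; apply/funext => i; case: dfwithP => [|i' si'].
      by rewrite sJ ltnSn addrC.
    rewrite /F ltnS leq_eqVlt (_ : _ == _ = false)//.
    by apply: contraNF si' => /eqP/val_inj->.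
  rewrite multilinear_formD gs; congr (A _ + _); apply/funext => i.
  case: dfwithP => [|i' si']; first by rewrite /c' !inE eqxx addr0.
  by rewrite /c' /F !inE eq_sym (negPf si') /= addrAC.
apply/funext => h; rewrite big_enum /= -(big_mkord xpredT (fun s => g s.+1 h - g s h)).
rewrite telescope_sumr//; congr (A _ - A _); apply/funext => i.
  by rewrite ltn_ord andbT -addrA; case: ifP => _; rewrite ?addr0// [h + x]addrC.
by rewrite ltn0 andbF addr0.
Qed.

End multilinear.

Lemma degree_le_homogeneous (E : normedModType K) k (P : E -> K) :
  continuous_homogeneous_polynomial k P -> degree_le k P.
Proof.
move=> [[A Alin PA] _].
rewrite (_ : P = fun h => A (fun i => 0 + (if i \in [set: 'I_k]%SET then h else 0))).
  by apply: degree_le_multilinear => //; rewrite cardsT card_ord.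
by apply/funext => h; rewrite PA; congr A; apply/funext => i; rewrite add0r inE.
Qed.

(** Continuity at 0 bounds [P] by 1 on a ball of radius [e]; scaling by a natural number [n > r / e]
    carries this to radius [r], with the bound [n ^ k]. *)
Lemma homogeneous_bounded (E : normedModType K) k (P : E -> K) :
  scalar_like K -> (0 < k)%N -> continuous_homogeneous_polynomial k P ->
  P 0 = 0 /\ forall r, exists M : K, forall x, `|x| <= r -> `|P x| <= M.
Proof.
move=> [arch _ _] k0 [[A Alin PA] Pc].
have PZ a x : P (a *: x) = a ^+ k * P x by rewrite !PA multilinear_form_diagZ.
have P0 : P 0 = 0 by rewrite -(scale0r (0 : E)) PZ expr0n gtn_eqF// mul0r.
split=> // r.
have /cvgrPdist_lt/(_ 1 ltr01) := Pc 0; rewrite P0 => /nbhs_normP[e /= e0 he].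
have {}he x : `|x| < e -> `|P x| < 1.
  by move=> xe; have := he x; rewrite /= !sub0r !normrN; exact.
have [n rn] := arch (r / e); exists (n%:R ^+ k) => x xr.
have r0 : 0 <= r by apply: le_trans xr.
have n0 : 0 < n%:R :> K by apply: le_lt_trans rn.
have -> : x = n%:R *: (n%:R^-1 *: x) by rewrite scalerA divff ?scale1r// gt_eqF.
rewrite PZ normrM normrX gtr0_norm// ler_piMr ?exprn_ge0 ?ltW//.
apply: he; rewrite normrZ gtr0_norm ?invr_gt0// mulrC ltr_pdivrMr//.
apply: le_lt_trans xr _; rewrite -ltr_pdivrMl// mulrC.
by move: rn; rewrite ger0_norm// divr_ge0// ltW.
Qed.

End polynomials.

(** * Sequences with bounded finite sums *)

Definition bounded_sums (K : numFieldType) (E : normedModType K)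
    (w : nat -> E) (C : K) :=
  forall s, uniq s -> `|\sum_(i <- s) w i| <= C.

(** Indices in [s] get the sign [+], those in [t] the sign [-]: up to a constant, this is domination
    by the unit vector basis of c0. *)
Definition bounded_signed_sums (K : numFieldType) (E : normedModType K)
    (w : nat -> E) (C : K) :=
  forall s t, uniq (s ++ t) -> `|\sum_(i <- s) w i - \sum_(i <- t) w i| <= C.

Lemma bounded_signed_sums_comp (K : numFieldType) (E : normedModType K)
    (w : nat -> E) (C : K) (f : nat -> nat) :
  injective f -> bounded_signed_sums w C -> bounded_signed_sums (w \o f) C.
Proof.
move=> fi hw s t st; have := hw (map f s) (map f t).
by rewrite !big_map -map_cat map_inj_uniq//; apply.
Qed.

Lemma bounded_sums_mean (K : numFieldType) (E : normedModType K)
    (w : nat -> E) (C : K) : scalar_like K -> bounded_sums w C ->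
  n.+1%:R^-1 *: (\sum_(i < n.+1) w i) @[n --> \oo] --> 0.
Proof.
move=> [arch _ _] hw; apply/cvg0P => e e0.
have C0 : 0 <= C by have := hw [::] isT; rewrite big_nil normr0.
have [N CN] := arch (C / e); exists N => n Nn.
have n0 : 0 < n.+1%:R :> K by rewrite ltr0n.
rewrite normrZ gtr0_norm ?invr_gt0// ltr_pdivrMl//.
apply: (@le_lt_trans _ _ C).
  by rewrite -(big_mkord xpredT w); apply: hw; rewrite /index_iota iota_uniq.
move: CN; rewrite ger0_norm ?divr_ge0 ?(ltW e0)// ltr_pdivrMr// => /lt_le_trans->//.
by rewrite ler_wpM2r ?(ltW e0)// ler_nat ltnW.
Qed.

(* If f (w n) had a cluster point a <> 0, then additivity up to small errors
   along a sparse subsequence would make f (w n_1 + ... + w n_m) grow like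
   m a, although these sums are bounded. *)
Lemma degree_le_cvg0 (K : numFieldType) (E : normedModType K)
    (w : nat -> E) (C : K) k (f : E -> K) :
  scalar_like K -> bounded_sums w C -> degree_le k f -> f 0 = 0 ->
  (forall r, exists M : K, forall x, `|x| <= r -> `|f x| <= M) ->
  f (w n) @[n --> \oo] --> 0.
Proof.
move=> hK hw; have [arch _ bw] := hK.
elim: k f => [|k ih] f fk f0 fb.
  rewrite (_ : (fun _ => _) = fun=> 0); first exact: cvg_cst.
  by apply/funext => n; rewrite (fk (w n)).
apply: contrapT => /not_cvg0P[e e0 he].
have [g gi ge] := frequently_subseq he.
have [M fM] := fb C.
have wC n : `|w n| <= C by have := hw [:: n] isT; rewrite big_seq1.
have [h hi [a ha]] := bw (fun n => f (w (g n))) M (fun n => fM _ (wC _)).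
(* A quarter of [e]: values of size at least [4 d] within [d] of [a] force [|a| >= 3 d], which beats
   the error [2 d] made with each new term. *)
have [d d0 ed] : exists2 d : K, 0 < d & e = d *+ 4.
  by exists (e / 4); rewrite ?divr_gt0// -(mulr_natr (e / 4)) divfK// pnatr_eq0.
move/cvgrPdist_lt : ha => /(_ d d0)[N1 _ hN1].
pose x l : E := \sum_(i <- l) w i.
have [l N|phi phii hphi] := @subseq_choice (fun l n =>
    [/\ `|f (x l + w n) - f (w n) - f (x l)| < d, `|a - f (w n)| < d
      & e <= `|f (w n)|]).
  (* For fixed [x l], the failure of additivity is a polynomial of lower degree vanishing at 0: the
     induction hypothesis applies. *)
  have /cvg0P/(_ d d0)[N2 hN2] :
      f (x l + w n) - f (w n) - f (x l) @[n --> \oo] --> 0.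
    apply: (ih (fun y => f (x l + y) - f y - f (x l))) => [||r].
    - by apply: degree_leD; [exact: fk|exact: degree_le_cst].
    - by rewrite addr0 f0 subr0 subrr.
    - have [M1 hM1] := fb (`|x l| + r); have [M2 hM2] := fb r.
      exists (M1 + M2 + `|f (x l)|) => y yr.
      apply: le_trans (ler_normB _ _) _; rewrite lerD2r.
      apply: le_trans (ler_normB _ _) _; rewrite lerD ?hM2// hM1//.
      by apply: le_trans (ler_normD _ _) _; rewrite lerD2l.
  pose m := maxn N (maxn N1 N2); pose n := g (h m).
  have mn : (m <= n)%N.
    exact: leq_trans (homo_ltn_ge hi _) (homo_ltn_ge gi _).
  exists n; first by apply: leq_trans mn; rewrite leq_maxl.
  split; last exact: ge.
  - by apply: hN2; apply: leq_trans mn; rewrite !leq_max leqnn !orbT.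
  - by apply: hN1 => /=; rewrite /m !leq_max leqnn orbT.
have a3 : d *+ 3 <= `|a|.
  have [_ a1 a2] := hphi 0; rewrite -(lerD2r d) -mulrSr -ed.
  apply: le_trans a2 _; rewrite -[X in `|X|](subrK a) addrC.
  by apply: le_trans (ler_normD _ _) _; rewrite lerD2l distrC ltW.
have sumP m : `|f (x (mkseq phi m)) - m%:R * a| <= m%:R * (d *+ 2).
  elim: m => [|m ihm]; first by rewrite /x big_nil f0 !mul0r subr0 normr0.
  have [h1 h2 _] := hphi m.
  have -> : x (mkseq phi m.+1) = x (mkseq phi m) + w (phi m).
    by rewrite /x mkseqS big_rcons /= addrC.
  set X := x _ in h1 ihm *; set W := w _ in h1 h2 *.
  have -> : f (X + W) - m.+1%:R * a = (f X - m%:R * a) +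
      ((f (X + W) - f W - f X) - (a - f W)).
    rewrite -natr1 mulrDl mul1r; move: (f (X + W)) (f W) (f X) (m%:R * a).
    by move=> p q r s; ring.
  rewrite -natr1 mulrDl mul1r; apply: le_trans (ler_normD _ _) _.
  rewrite lerD// (le_trans (ler_normB _ _))// mulr2n lerD// ltW//.
have [M' fM'] := fb C.
have [n] := arch (M' / d).
have M0 : 0 <= M' by apply: le_trans (fM' 0 _); rewrite ?normr0// (le_trans _ (wC 0%N)).
rewrite ger0_norm ?divr_ge0 ?(ltW d0)// => nM.
(* From [3 d n <= n |a| <= M' + 2 d n] follows [n <= M' / d], against the choice of [n]. *)
suff /le_lt_trans/(_ nM) : n%:R <= M' / d by rewrite ltxx.
rewrite ler_pdivlMr// -(lerD2l (n%:R * (d *+ 2))) -mulrDr -mulrSr.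
apply: (@le_trans _ _ (n%:R * `|a|)); first by rewrite ler_wpM2l.
have -> : n%:R * `|a| = `|n%:R * a| by rewrite normrM normr_nat.
rewrite -[n%:R * a](subKr (f (x (mkseq phi n)))).
apply: le_trans (ler_normB _ _) _; rewrite addrC lerD//.
apply/fM'/hw/mkseq_uniqP => i j _ _; exact: homo_ltn_inj.
Qed.

Lemma bounded_sums_polynomial (K : numFieldType) (E : normedModType K)
    (w : nat -> E) (C : K) k (P : E -> K) :
  scalar_like K -> bounded_sums w C -> (0 < k)%N ->
  continuous_homogeneous_polynomial k P -> P (w n) @[n --> \oo] --> 0.
Proof.
move=> hK hw k0 Pk; have [P0 Pb] := homogeneous_bounded hK k0 Pk.
exact: (degree_le_cvg0 hK hw (degree_le_homogeneous Pk)).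
Qed.

(** * Elementary tensors in the projective norm *)

(** The one-term representation bounds the infimum, which is not the default 0: the set is nonempty
    and [scalar_like] provides a greatest lower bound. *)
Lemma projective_norm_le (K : numFieldType) (E F : normedModType K)
    (T : lmodType K) (tau : {bilinear E -> F -> T}) u v :
  scalar_like K -> projective_norm tau (tau u v) <= `|u| * `|v|.
Proof.
move=> [_ hinf _]; rewrite /projective_norm /infimum.
set A := [set _ | _ in _]; have Auv : A (`|u| * `|v|).
  by exists [:: (u, v)]; rewrite /= big_seq1.
rewrite ifF; last by apply/negP => /eqP A0; rewrite A0 in Auv.
case: xgetP => [z _ [+ _]|nA]; first exact.
have [||m [mA Am]] := hinf A; first by exists (`|u| * `|v|).
  by move=> _ [s _ <-]; apply: sumr_ge0 => uv _; rewrite mulr_ge0.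
by case: (nA m); split.
Qed.

(* (u + x) (x) (v + y) + (u - x) (x) (v - y) = 2 (u (x) v + x (x) y): summing
   over all choices of signs leaves the diagonal sum. *)
Lemma bounded_sums_tensor (K : numFieldType) (E F : normedModType K)
    (U : lmodType K) (tau : {bilinear E -> F -> U})
    (T : normedModType K) (j : {linear U -> T}) (x : nat -> E) (y : nat -> F)
    (C D : K) :
  (forall u v, `|j (tau u v)| <= `|u| * `|v|) ->
  bounded_signed_sums x C -> bounded_signed_sums y D ->
  bounded_sums (fun n => j (tau (x n) (y n))) (C * D).
Proof.
move=> jtau hx hy l ul.
(* Generalized for an induction on [l]: the indices in [s] and [t] have received their signs, those
   in [l] are still to be averaged over. *)
suff h s t : uniq (s ++ t ++ l) ->
    `|j (tau (\sum_(i <- s) x i - \sum_(i <- t) x i)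
            (\sum_(i <- s) y i - \sum_(i <- t) y i))
      + \sum_(i <- l) j (tau (x i) (y i))| <= C * D.
  by have := h [::] [::] ul; rewrite !big_nil subrr linear0l linear0 add0r.
elim: l {ul} s t => [|i l ih] s t.
  rewrite cats0 big_nil addr0 => st; apply: le_trans (jtau _ _) _.
  by rewrite ler_pM// ?hx ?hy.
move=> stl.
have := ih (i :: s) t; have := ih s (i :: t).
have -> : uniq (s ++ (i :: t) ++ l) = true.
  rewrite -stl; apply: perm_uniq; apply/permP => p.
  by rewrite !count_cat /= -!addnA; congr addn; rewrite addnCA.
have -> : uniq ((i :: s) ++ t ++ l) = true.
  rewrite -stl; apply: perm_uniq; apply/permP => p.
  by rewrite /= !count_cat /= addnCA; congr addn; rewrite addnCA.
rewrite !big_cons => /(_ isT) h1 /(_ isT) h2.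
have := le_trans (ler_normD _ _) (lerD h2 h1).
move: (\sum_(i <- s) x i) (\sum_(i <- t) x i) (\sum_(i <- s) y i)
  (\sum_(i <- t) y i) (\sum_(i <- l) _) (x i) (y i) => a b c e z p q.
have e1 (V : zmodType) (f g h : V) : f + g - h = g - h + f.
  by rewrite [f + g]addrC addrAC.
have e2 (V : zmodType) (f g h : V) : g - (f + h) = g - h - f.
  by rewrite opprD addrCA addrC.
rewrite (e1 _ p a b) (e1 _ q c e) (e2 _ p a b) (e2 _ q c e).
move: (a - b) (c - e) => u v.
suff -> : j (tau (u + p) (v + q)) + z + (j (tau (u - p) (v - q)) + z) =
    (j (tau u v) + (j (tau p q) + z)) *+ 2.
  by rewrite normrMn -mulr2n lerMn2r.
have e3 : v + q + (v - q) = v *+ 2 by rewrite addrACA subrr addr0.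
have e4 : v + q - (v - q) = q *+ 2.
  by rewrite opprB (addrC v) addrACA subrr addr0.
rewrite addrACA -linearD /= linearDl linearBl addrACA.
rewrite -linearDr -linearBr e3 e4 -!mulr2n linearMnr linearMnr -mulrnDl.
by rewrite raddfMn raddfD [j _ + (_ + _)]addrA [RHS]mulrnDl addrA.
Qed.

(** * Limits and order *)

Section limits.
Context (K : numFieldType).

Lemma cvg0_le (E : normedModType K) (I : Type) (F : set_system I) (FF : Filter F)
    (u : I -> E) (b : I -> K) :
  (forall i, `|u i| <= b i) -> b i @[i --> F] --> 0 -> u i @[i --> F] --> 0.
Proof.
move=> ub /cvgr0Pnorm_lt b0; apply/cvgr0Pnorm_lt => e e0.
apply: filterS (b0 e e0) => i; apply: le_lt_trans; apply: le_trans (ub i) _.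
by rewrite ger0_norm// (le_trans _ (ub i)).
Qed.

(** A nonnegative sequence is its own sequence of norms, so it tends both to [l] and to [|l|]; this
    also covers the partial order of R[i]. *)
Lemma cvg_ge0 (a : nat -> K) (l : K) :
  (forall n, 0 <= a n) -> a n @[n --> \oo] --> l -> 0 <= l.
Proof.
move=> a0 al; suff -> : l = `|l| by [].
apply: (norm_cvg_unique (F := a n @[n --> \oo])) => //=.
have na : (fun n => `|a n|) = a by apply/funext => n; rewrite ger0_norm.
by have := @cvg_norm K _ _ _ eventually_filter _ _ al; rewrite na.
Qed.

Lemma cvg_exp2V : scalar_like K -> (2 ^- n : K) @[n --> \oo] --> 0.
Proof.
move=> [arch _ _]; apply/cvg0P => e e0; have [N eN] := arch e^-1.
exists N => n Nn; rewrite gtr0_norm ?invr_gt0 ?exprn_gt0//.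
rewrite invf_plt ?posrE ?exprn_gt0//.
rewrite gtr0_norm ?invr_gt0// in eN; apply: lt_trans eN _.
by rewrite -natrX ltr_nat; apply: leq_ltn_trans Nn _; exact: ltn_expl.
Qed.

End limits.

(** * Bounded bilinear forms and their extension to a completion *)

Section bilinear_forms.
Context (K : numFieldType).

Lemma scalarB (V : lmodType K) (f : V -> K) :
  scalar f -> forall x y, f (x - y) = f x - f y.
Proof.
by move=> fl x y; have := fl (-1) y x; rewrite scaleN1r mulN1r ![- _ + _]addrC.
Qed.

Hypothesis hK : scalar_like K.

Section extension.
Context (U : lmodType K) (S : normedModType K) (j : {linear U -> S}).
Hypothesis jd : dense (range j).
Variables (B : U -> U -> K) (M : K).
Hypotheses (Bl : forall v, scalar (B^~ v)) (Br : forall u, scalar (B u)).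
Hypothesis Bb : forall u v, `|B u v| <= M * (`|j u| * `|j v|).

Lemma dense_approx (s : S) (e : K) : 0 < e -> exists u, `|s - j u| < e.
Proof.
move=> e0; have [z [/= sz [u _ uz]]] : ball s e `&` range j !=set0.
  by apply: jd; [exists s; exact: ballxx|exact: ball_open].
by exists u; move: sz; rewrite -uz -ball_normE.
Qed.

Lemma bilinearB_le u v u' v' : `|B u v - B u' v'| <=
  M * (`|j u - j u'| * `|j v| + `|j u'| * `|j v - j v'|).
Proof.
have -> : B u v - B u' v' = B (u - u') v + B u' (v - v').
  by rewrite (scalarB (Bl v)) (scalarB (Br u')); ring.
rewrite mulrDr -!linearB; apply: le_trans (ler_normD _ _) _.
by rewrite lerD// Bb.
Qed.

(** [a] is a cluster value along one bounded pair of approximating sequences; by [bilinearB_le], the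
    values along any other pair differ from that subsequence by a null sequence. *)
Lemma bilinear_limit (s t : S) : exists a : K, forall u v : nat -> U,
  j (u n) @[n --> \oo] --> s -> j (v n) @[n --> \oo] --> t ->
  B (u n) (v n) @[n --> \oo] --> a.
Proof.
have approx (r : S) : exists u : nat -> U,
    j (u n) @[n --> \oo] --> r /\ forall n, `|j (u n)| <= `|r| + 1.
  have /choice[u hu] n : exists u, `|r - j u| < 2 ^- n.
    by apply: dense_approx; rewrite invr_gt0 exprn_gt0.
  exists u; split=> [|n].
    apply: (cvg_sub0 _ (cvg_cst r)); apply: cvg0_le (cvg_exp2V hK) => n /=.
    by rewrite distrC ltW.
  rewrite -[j _](subrK r) addrC; apply: le_trans (ler_normD _ _) _.
  rewrite lerD2l distrC (le_trans (ltW (hu n)))// invf_le1 ?exprn_gt0//.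
  by rewrite exprn_ege1// ler1n.
have [u0 [us ub]] := approx s; have [v0 [vt vb]] := approx t.
have [_ _ bw] := hK.
have [n|f fi [a fa]] := bw (fun n => B (u0 n) (v0 n))
    (`|M| * ((`|s| + 1) * (`|t| + 1))).
  apply: le_trans (real_ler_norm _) _; first by [].
  rewrite normr_id; apply: le_trans (Bb _ _) _.
  apply: le_trans (real_ler_norm _) _.
    by rewrite ger0_real// (le_trans _ (Bb _ _)).
  by rewrite !normrM !normr_id ler_wpM2l// ler_pM.
exists a => u v hu hv.
have fo := homo_ltn_cvg fi.
apply: (cvg_sub0 _ fa).
apply: (@cvg0_le _ K^o) => [n|]; first exact: bilinearB_le.
have us' : j (u0 (f n)) @[n --> \oo] --> s := cvg_comp _ _ fo us.
have vt' : j (v0 (f n)) @[n --> \oo] --> t := cvg_comp _ _ fo vt.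
rewrite -(mulr0 M); apply: cvgM; first exact: cvg_cst.
rewrite -[X in _ --> X](addr0 0); apply: cvgD.
  rewrite -(mul0r `|t|); apply: cvgM; last exact: cvg_norm.
  rewrite -(normr0 S) -(subrr s); apply: cvg_norm; exact: cvgB.
rewrite -(mulr0 `|s|); apply: cvgM; first exact: cvg_norm.
rewrite -(normr0 S) -(subrr t); apply: cvg_norm; exact: cvgB.
Qed.

(** As the limit does not depend on the approximating sequences, linearity and the bound pass to it,
    and constant sequences give back [B]. *)
Lemma bilinear_extension : exists C : S -> S -> K,
  [/\ forall t, scalar (C^~ t), forall s, scalar (C s),
      forall s t, `|C s t| <= M * (`|s| * `|t|)
    & forall u v, C (j u) (j v) = B u v].
Proof.
have /choice[C0 hC0] (st : S * S) := bilinear_limit st.1 st.2.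
pose C s t := C0 (s, t).
have hC s t : forall u v : nat -> U, j (u n) @[n --> \oo] --> s ->
    j (v n) @[n --> \oo] --> t -> B (u n) (v n) @[n --> \oo] --> C s t.
  exact: (hC0 (s, t)).
have approx (r : S) : exists u : nat -> U, j (u n) @[n --> \oo] --> r.
  have /choice[u hu] n : exists u, `|r - j u| < 2 ^- n.
    by apply: dense_approx; rewrite invr_gt0 exprn_gt0.
  exists u; apply: (cvg_sub0 _ (cvg_cst r)).
  by apply: cvg0_le (cvg_exp2V hK) => n /=; rewrite distrC ltW.
have jP a s s' (u u' : nat -> U) : j (u n) @[n --> \oo] --> s ->
    j (u' n) @[n --> \oo] --> s' ->
    j (a *: u n + u' n) @[n --> \oo] --> a *: s + s'.
  move=> us us'; rewrite (_ : (fun _ => _) = fun n => a *: j (u n) + j (u' n)).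
    by apply: cvgD => //; exact: cvgZr.
  by apply/funext => n; rewrite linearP.
exists C; split=> [t a s s'|s a t t'|s t|u v].
- have [u hu] := approx s; have [u' hu'] := approx s'; have [v hv] := approx t.
  apply: (norm_cvg_unique (F := B (a *: u n + u' n) (v n) @[n --> \oo])).
    by apply: hC => //; exact: jP.
  rewrite /= (_ : (fun _ => _) = fun n => a * B (u n) (v n) + B (u' n) (v n)).
    by apply: cvgD; [apply: cvgM; [exact: cvg_cst|exact: hC]|exact: hC].
  by apply/funext => n; exact: Bl.
- have [u hu] := approx t; have [u' hu'] := approx t'; have [v hv] := approx s.
  apply: (norm_cvg_unique (F := B (v n) (a *: u n + u' n) @[n --> \oo])).
    by apply: hC => //; exact: jP.
  rewrite /= (_ : (fun _ => _) = fun n => a * B (v n) (u n) + B (v n) (u' n)).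
    by apply: cvgD; [apply: cvgM; [exact: cvg_cst|exact: hC]|exact: hC].
  by apply/funext => n; exact: Br.
- have [u hu] := approx s; have [v hv] := approx t.
  rewrite -subr_ge0; apply: cvg_ge0; last first.
    apply: cvgB; last by apply: cvg_norm; apply: hC; [exact: hu|exact: hv].
    apply: cvgM; first exact: cvg_cst.
    by apply: cvgM; apply: cvg_norm; [exact: hu|exact: hv].
  by move=> n; rewrite subr_ge0.
- apply: (norm_cvg_unique (F := (fun=> B u v) n @[n --> \oo])).
    by apply: hC; exact: cvg_cst.
  exact: cvg_cst.
Qed.

End extension.

Lemma bilinear_diag_polynomial (S : normedModType K) (C : S -> S -> K) (M : K) :
  (forall t, scalar (C^~ t)) -> (forall s, scalar (C s)) ->
  (forall s t, `|C s t| <= M * (`|s| * `|t|)) ->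
  continuous_homogeneous_polynomial 2 (fun s => C s s).
Proof.
move=> Cl Cr Cb; split.
  exists (fun f => C (f ord0) (f ord_max)) => // f i a u v.
  have [->|->] : i = ord0 \/ i = ord_max.
  - by case: i => [[|[|//]]] p; [left|right]; exact: val_inj.
  - by rewrite !dfwithin !dfwithout//; exact: Cl.
  - by rewrite !dfwithin !dfwithout//; exact: Cr.
move=> s; apply/subr_cvg0.
apply: (@cvg0_le _ K^o _ _ _ _
  (fun t => M * (`|t - s| * `|t| + `|s| * `|t - s|))) => [t|].
  have -> : C t t - C s s = C (t - s) t + C s (t - s).
    by rewrite (scalarB (Cl t)) (scalarB (Cr s)); ring.
  rewrite mulrDr; apply: le_trans (ler_normD _ _) _.
  by rewrite lerD.
have ts : t - s @[t --> s] --> 0 by apply/subr_cvg0.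
rewrite -(mulr0 M); apply: cvgM; first exact: cvg_cst.
rewrite -[X in _ --> X](addr0 0); apply: cvgD.
  rewrite -(mul0r `|s|); apply: cvgM; last exact: cvg_norm.
  rewrite -(normr0 S); exact: cvg_norm.
rewrite -(mulr0 `|s|); apply: cvgM; first exact: cvg_cst.
rewrite -(normr0 S); exact: cvg_norm.
Qed.

(* The approximations are so close to x n that they are null for every bounded
   bilinear form, although x n is not yet known to be bounded. *)
Lemma P_null_approx (U : lmodType K) (S : normedModType K) (j : {linear U -> S})
    (x : nat -> S) : dense (range j) -> P_null x ->
  exists2 v : nat -> U, forall n, `|x n - j (v n)| <= 2 ^- n &
    forall (B : U -> U -> K) (M : K),
      (forall v, scalar (B^~ v)) -> (forall u, scalar (B u)) ->
      (forall u v, `|B u v| <= M * (`|j u| * `|j v|)) ->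
      B (v n) (v n) @[n --> \oo] --> 0.
Proof.
(* Moving [x n] by at most [e n <= 1] changes the form by at most [2 |M| e n (1 + |x n|)], here
   [2 |M| 2 ^- n]. *)
move=> jd xnull; pose e n := 2 ^- n / (1 + `|x n|).
have x1 n : 0 < 1 + `|x n| by rewrite ltr_pwDl.
have e0 n : 0 < e n by rewrite divr_gt0// invr_gt0 exprn_gt0.
have /choice[v hv] n : exists u, `|x n - j u| < e n by exact: dense_approx.
have eM n : e n * (1 + `|x n|) = 2 ^- n by rewrite divfK// gt_eqF.
have e2 n : e n <= 2 ^- n by rewrite -eM ler_peMr ?lerDl// ltW.
have e1 n : e n <= 1.
  by rewrite (le_trans (e2 n))// invf_le1 ?exprn_gt0// exprn_ege1// ler1n.
exists v => [n|B M Bl Br Bb]; first exact: le_trans (ltW (hv n)) (e2 n).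
have [C [Cl Cr Cb CB]] := bilinear_extension jd Bl Br Bb.
have := xnull 2%N _ isT (bilinear_diag_polynomial Cl Cr Cb).
apply: cvg_sub0; apply: (@cvg0_le _ K^o _ _ _ _ (fun n => `|M| * 2 * 2 ^- n)).
  move=> n /=.
  rewrite !fctE -CB; have -> : C (j (v n)) (j (v n)) - C (x n) (x n) =
      C (j (v n) - x n) (j (v n)) + C (x n) (j (v n) - x n).
    by rewrite (scalarB (Cl (j (v n)))) (scalarB (Cr (x n))); ring.
  have Cb' s t : `|C s t| <= `|M| * (`|s| * `|t|).
    apply: le_trans (Cb s t) _.
    apply: le_trans (real_ler_norm _) _.
      by rewrite ger0_real// (le_trans _ (Cb s t)).
    by rewrite !normrM !normr_id.
  have jx : `|j (v n) - x n| <= e n by rewrite distrC ltW.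
  apply: le_trans (ler_normD _ _) _; rewrite -mulrA mulr_natl mulr2n mulrDr.
  rewrite -eM lerD// (le_trans (Cb' _ _))// ler_wpM2l// .
    rewrite ler_pM// -[j _](subrK (x n)); apply: le_trans (ler_normD _ _) _.
    by rewrite lerD2r (le_trans jx).
  by rewrite mulrC ler_pM// lerDr.
rewrite -(mulr0 (`|M| * 2)); apply: cvgM; first exact: cvg_cst.
exact: cvg_exp2V.
Qed.

End bilinear_forms.

(** * Elementary estimates of sums *)

Lemma sum_uniq_le (K : numDomainType) (s : seq nat) (f : nat -> K) (N : nat) :
  uniq s -> (forall i, 0 <= f i) -> (forall i, i \in s -> (N <= i)%N -> f i = 0) ->
  \sum_(i <- s) f i <= \sum_(i < N) f i.
Proof.
move=> us f0 sN.
have -> : \sum_(i <- s) f i = \sum_(i <- s | (i < N)%N) f i.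
  rewrite (bigID (fun i => (i < N)%N)) /= [X in _ + X]big_seq_cond [X in _ + X]big1 ?addr0//.
  by move=> i /andP[si]; rewrite -leqNgt; exact: sN.
have ss : perm_eq [seq i <- s | (i < N)%N] [seq i <- iota 0 N | i \in s].
  apply: uniq_perm; rewrite ?filter_uniq ?iota_uniq// => i.
  by rewrite !mem_filter mem_iota add0n andbC.
rewrite -(big_mkord xpredT f) /index_iota subn0 -[leLHS]big_filter (perm_big _ ss).
by rewrite big_filter [leRHS](bigID (mem s)) /= lerDl sumr_ge0.
Qed.

Lemma sum_exp2V (K : numFieldType) (N : nat) : \sum_(i < N) (2 ^- i : K) <= 2.
Proof.
suff h : \sum_(i < N) (2 ^- i : K) + 2 * 2 ^- N = 2.
  by rewrite -[leRHS]h lerDl mulr_ge0// invr_ge0 exprn_ge0.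
elim: N => [|N ih]; first by rewrite big_ord0 add0r expr0 invr1 mulr1.
rewrite -[RHS]ih big_ord_recr /= -addrA; congr (_ + _).
by rewrite exprS invfM mulrA divff// mul1r mulr_natl mulr2n.
Qed.

(** * The Schreier norm on c00 and its l2 estimate *)

Section schreier.
Context (K : numFieldType).
Hypothesis hK : scalar_like K.
Local Notation p := (@schreier_norm K).
Implicit Types x y : c00 K.

Lemma c00_support x : exists L, forall n, (L <= n)%N -> x n = 0.
Proof.
case: x => x /= /asboolP fx; exists (\max_(i <- fset_set [set n | x n != 0]) i).+1.
move=> n; apply: contraTeq => xn; rewrite -leqNgt.
by apply: (leq_bigmax_seq (F := id)) => //; rewrite in_fset_set// inE.
Qed.

Lemma c00_sum (I : Type) (s : seq I) (w : I -> c00 K) j :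
  (\sum_(i <- s) w i) j = \sum_(i <- s) w i j.
Proof. exact: (big_morph (fun x : c00 K => x j)). Qed.

(** The supremum is not the default 0: it is the infimum of the upper bounds, which exist by finite
    support and are nonnegative because the empty set is admissible. *)
Lemma schreier_norm_sup x :
  (forall A, admissible A -> \sum_(n <- A) `|x n| <= p x) /\
  (forall C, (forall A, admissible A -> \sum_(n <- A) `|x n| <= C) -> p x <= C).
Proof.
have [_ hinf _] := hK; have [L hL] := c00_support x.
have ad0 : admissible fset0 by move=> n; rewrite inE.
pose U : set K := [set C | forall A, admissible A -> \sum_(n <- A) `|x n| <= C].
have [||m [mU Um]] := hinf U.
- exists (\sum_(i < L) `|x i|) => A _.
  by apply: sum_uniq_le => [|//|i _ /hL->]; [exact: fset_uniq|exact: normr0].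
- by move=> C /(_ fset0 ad0); rewrite big_seq_fset0.
have Em : supremums [set \sum_(n <- A) `|x n| | A in admissible] m.
  split=> [_ [A aA <-]|C hC]; first by apply: Um => C; exact.
  by apply: mU => A aA; apply: hC; exists A.
rewrite /schreier_norm /supremum ifF; last first.
  apply/negP => /eqP E0; suff : (set0 : set K) (\sum_(n <- fset0) `|x n|) by [].
  by rewrite -E0; exists fset0.
case: xgetP => [z _ [zu zl]|/(_ m)//]; split=> [A aA|C hC].
  by apply: zu; exists A.
by apply: zl => _ [A aA <-]; exact: hC.
Qed.

Lemma schreier_norm_ge x (s : seq nat) : uniq s ->
  (forall n, n \in s -> (size s <= n.+1)%N) -> \sum_(n <- s) `|x n| <= p x.
Proof.
move=> us hs; pose A := [fset n in s]%fset.
have As : perm_eq s A by apply: uniq_perm => // [|n]; [exact: fset_uniq|rewrite in_fset].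
rewrite (perm_big _ As); apply: (schreier_norm_sup x).1 => n.
by rewrite in_fset /= -(perm_size As); exact: hs.
Qed.

Lemma schreier_norm_coord x j : `|x j| <= p x.
Proof.
by have := @schreier_norm_ge x [:: j]; rewrite big_seq1; exact.
Qed.

Lemma schreier_norm_ge0 x : 0 <= p x.
Proof. exact: le_trans (schreier_norm_coord x 0%N). Qed.

(* The upper half of s is admissible. *)
Lemma schreier_norm_weak_l1 x (s : seq nat) (c : K) : uniq s -> 0 <= c ->
  (forall j, j \in s -> c <= `|x j|) -> (size s)%:R * c <= 2 * p x.
Proof.
move=> us c0 hs; pose n := size s; pose t := [seq j <- s | (n./2 <= j)%N].
(* At most [n./2] entries of [s] lie below [n./2], so at least [uphalf n] remain. Index [n./2]
   stands for the integer [n./2 + 1 >= uphalf n], whence admissibility. *)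
pose r := take (uphalf n) t.
have szt : (uphalf n <= size t)%N.
  have : (size [seq j <- s | (j < n./2)%N] <= n./2)%N.
    rewrite -[X in (_ <= X)%N](size_iota 0); apply: uniq_leq_size.
      by rewrite filter_uniq.
    by move=> j; rewrite mem_filter mem_iota => /andP[->].
  have := count_predC (fun j => (n./2 <= j)%N) s.
  rewrite !size_filter (@eq_count _ (predC _) (fun j => (j < n./2)%N)).
    by rewrite -/n; lia.
  by move=> j /=; rewrite ltnNge.
have szr : size r = uphalf n by rewrite size_takel.
have ur : uniq r by rewrite take_uniq// filter_uniq.
have rP j : j \in r -> (n./2 <= j)%N /\ j \in s.
  by move=> /mem_take; rewrite mem_filter => /andP[].
have : \sum_(j <- r) `|x j| <= p x.
  apply: schreier_norm_ge => // j /rP[nj _]; rewrite szr uphalf_half.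
  by apply: (@leq_trans n./2.+1) => //; rewrite -add1n leq_add2r leq_b1.
have : \sum_(j <- r) c <= \sum_(j <- r) `|x j|.
  by rewrite big_seq [leRHS]big_seq; apply: ler_sum => j /rP[_ /hs].
rewrite big_const_seq count_predT szr iter_addr_0 => /le_trans/[apply].
rewrite -[c *+ _]mulr_natl => h.
apply: le_trans (_ : 2 * ((uphalf n)%:R * c) <= _); last by rewrite ler_wpM2l.
by rewrite mulrA -natrM ler_wpM2r// ler_nat -/n; lia.
Qed.

Lemma exists_min_norm x (s : seq nat) : (0 < size s)%N ->
  exists2 m, m \in s & forall j, j \in s -> `|x m| <= `|x j|.
Proof.
elim: s => [//|i [_ _|k s /(_ isT)[m ms hm] _]].
  by exists i => [|j]; rewrite inE// => /eqP->.
have [im|mi] := real_leP (normr_real (x i)) (normr_real (x m)).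
  exists i; first exact: mem_head.
  by move=> j; rewrite inE => /predU1P[->//|/hm]; exact: le_trans.
exists m; first by rewrite inE ms orbT.
by move=> j; rewrite inE => /predU1P[->|/hm//]; exact: ltW.
Qed.

(** Induction on a sharper bound, from [1 / (t + 1) ^ 2 <= 1 / t - 1 / (t + 1)]. *)
Lemma sum_invn_sqr N : \sum_(i < N) (i.+1%:R ^- 2 : K) <= 2.
Proof.
case: N => [|N]; first by rewrite big_ord0.
suff h : \sum_(i < N.+1) (i.+1%:R ^- 2 : K) <= 2 - N.+1%:R^-1.
  by apply: le_trans h _; rewrite gerBl invr_ge0.
elim: N => [|N ih].
  by rewrite big_ord_recr big_ord0 /= add0r expr1n invr1 lerBrDr.
rewrite big_ord_recr /=; apply: le_trans (lerD ih (lexx _)) _.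
have -> : (N.+1%:R^-1 : K) = N.+2%:R^-1 + N.+1%:R^-1 * N.+2%:R^-1.
  have t0 : N.+1%:R != 0 :> K by rewrite pnatr_eq0.
  have : N.+2%:R != 0 :> K by rewrite pnatr_eq0.
  rewrite -[N.+2%:R]natr1; move: (N.+1%:R) t0 => t t0 t1; field.
  by rewrite t0 t1.
rewrite opprD !addrA -[leLHS]addrA gerDl addrC subr_le0 -exprVn expr2.
by rewrite ler_wpM2r ?invr_ge0// lef_pV2 ?posrE ?ltr0n// ler_nat.
Qed.

(** The smallest of [n] entries is at most [2 p(x) / n] by [schreier_norm_weak_l1]. Removing it and
    repeating compares the squares with the sum of [4 p(x) ^ 2 / n ^ 2], whence [8 = 4 * 2]. *)
Lemma schreier_norm_l2 x (s : seq nat) :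
  uniq s -> \sum_(j <- s) `|x j| ^+ 2 <= 8 * p x ^+ 2.
Proof.
move=> us; suff h : \sum_(j <- s) `|x j| ^+ 2 <=
    4 * p x ^+ 2 * \sum_(i < size s) i.+1%:R ^- 2.
  apply: le_trans h _; have -> : 8 * p x ^+ 2 = 4 * p x ^+ 2 * 2 by ring.
  by rewrite ler_wpM2l ?sum_invn_sqr// mulr_ge0// exprn_ge0// schreier_norm_ge0.
move: {2}(size s) (erefl (size s)) us => n; elim: n s => [|n ih] s sn us.
  by rewrite (size0nil sn) big_nil big_ord0 mulr0.
have [|m ms hm] := @exists_min_norm x s; first by rewrite sn.
rewrite (perm_big _ (perm_to_rem ms)) big_cons sn big_ord_recr /= addrC mulrDr.
have sr : size (rem m s) = n by rewrite size_rem// sn.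
apply: lerD; first by have := ih _ sr (rem_uniq _ us); rewrite sr.
have := schreier_norm_weak_l1 us (normr_ge0 _) hm; rewrite sn mulrC.
rewrite -ler_pdivlMr ?ltr0n// => xm.
have -> : 4 * p x ^+ 2 * n.+1%:R ^- 2 = (2 * p x / n.+1%:R) ^+ 2.
  by rewrite !exprMn exprVn -[2 ^+ 2]natrX.
by rewrite lerXn2r ?nnegrE// (le_trans _ xm).
Qed.

(** After division by [s] and [t], the termwise [2 a b <= a ^ 2 + b ^ 2] suffices and no square root
    occurs. *)
Lemma cauchy_schwarz_scaled (a b : nat -> K) (N : nat) (M s t : K) :
  (forall i, 0 <= a i) -> (forall i, 0 <= b i) -> 0 < s -> 0 < t ->
  \sum_(i < N) a i ^+ 2 <= M * s ^+ 2 -> \sum_(i < N) b i ^+ 2 <= M * t ^+ 2 ->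
  \sum_(i < N) a i * b i <= M * (s * t).
Proof.
move=> a0 b0 s0 t0 ha hb.
have ha' : \sum_(i < N) (a i / s) ^+ 2 <= M.
  under eq_bigr do rewrite exprMn exprVn.
  by rewrite -mulr_suml ler_pdivrMr// exprn_gt0.
have hb' : \sum_(i < N) (b i / t) ^+ 2 <= M.
  under eq_bigr do rewrite exprMn exprVn.
  by rewrite -mulr_suml ler_pdivrMr// exprn_gt0.
rewrite -ler_pdivrMr ?mulr_gt0//.
have -> : (\sum_(i < N) a i * b i) / (s * t) = \sum_(i < N) (a i / s) * (b i / t).
  by rewrite mulr_suml; apply: eq_bigr => i _; rewrite mulf_div.
rewrite -(ler_pM2l (ltr0n K 2)) [leRHS]mulr_natl [leRHS]mulr2n.
apply: le_trans (lerD ha' hb'); rewrite -big_split mulr_sumr /=.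
apply: ler_sum => i _.
have ar : a i / s \is Num.real by rewrite ger0_real// divr_ge0// ltW.
have br : b i / t \is Num.real by rewrite ger0_real// divr_ge0// ltW.
rewrite -subr_ge0 (_ : _ - _ = (a i / s - b i / t) ^+ 2); last by ring.
by rewrite real_exprn_even_ge0// rpredB.
Qed.

End schreier.

(** * Sequences in c00 null for bounded bilinear forms: gliding humps *)

Section bilinear_null.
Context (K : numFieldType).
Hypothesis hK : scalar_like K.
Local Notation p := (@schreier_norm K).
Implicit Types (x y : c00 K) (v : nat -> c00 K) (psi : c00 K -> K).

Definition bilinear_null v :=
  forall (B : c00 K -> c00 K -> K) (M : K),
    (forall y, scalar (B^~ y)) -> (forall x, scalar (B x)) ->
    (forall x y, `|B x y| <= M * (p x * p y)) ->
    B (v n) (v n) @[n --> \oo] --> 0.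

Definition bounded_functional psi :=
  scalar psi /\ exists C : K, forall x, `|psi x| <= C * p x.

Lemma bilinear_null_functional v psi : bilinear_null v -> bounded_functional psi ->
  psi (v n) ^+ 2 @[n --> \oo] --> 0.
Proof.
move=> hv [psil [C hC]].
apply: (hv (fun x y => psi x * psi y) (C * C)).
- by move=> y a x x' /=; rewrite psil; ring.
- by move=> y a x x' /=; rewrite psil; ring.
- move=> x y; rewrite normrM mulrACA; exact: ler_pM.
Qed.

Lemma bounded_functional_coord j : bounded_functional (fun x => x j).
Proof.
split; first by move=> a x y.
by exists 1 => x; rewrite mul1r schreier_norm_coord.
Qed.

Lemma bilinear_null_coord v L (e : K) : bilinear_null v -> 0 < e ->
  exists N, forall n, (N <= n)%N -> forall j, (j < L)%N -> `|v n j| < e.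
Proof.
move=> hv e0; elim: L => [|L [N hN]]; first by exists 0%N.
have /cvg0P/(_ _ (exprn_gt0 2 e0))[N' hN'] :=
  bilinear_null_functional hv (bounded_functional_coord L).
exists (maxn N N') => n; rewrite geq_max => /andP[Nn N'n] j.
rewrite ltnS leq_eqVlt => /predU1P[->|]; last exact: hN.
have := hN' n N'n; rewrite normrX ltr_pXn2r ?nnegrE// ltW//.
Qed.

(* The form B(x, y) = sum_m psi_m(x) psi_m(y) is bounded, and the choice of
   (n_m, psi_m) makes |B(v n_m, v n_m)| >= 2 d - d, the later terms being 0. *)
Lemma gliding_hump v (G : nat -> (c00 K -> K) -> Prop) (d M : K) :
  bilinear_null v -> 0 < d ->
  (forall psi : nat -> c00 K -> K, injective psi -> (forall m, G m (psi m)) ->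
    forall N x, \sum_(m < N) `|psi m x| ^+ 2 <= M * p x ^+ 2) ->
  (forall k L N, exists2 n, (N <= n)%N & exists psi, [/\ G k psi,
    bounded_functional psi, forall x, (forall j, (L <= j)%N -> x j = 0) -> psi x = 0
    & d *+ 2 <= `|psi (v n)| ^+ 2]) ->
  False.
Proof.
move=> hv d0 hbound hump.
have [sb hsb] := choice (@c00_support K).
pose X := {np : nat * (c00 K -> K) | bounded_functional np.2}.
(* Ignoring the coordinates below [L h], the next functional kills the vectors chosen so far; thanks
   to [size h], a fixed [x] is killed by all but finitely many functionals. *)
pose L (h : seq X) := maxn (size h) (\max_(i <- h) sb (v (sval i).1)).
have [h|s hs] := @history_choice X (fun h i =>
    [/\ (size h <= (sval i).1)%N, G (size h) (sval i).2,
     forall x, (forall j, (L h <= j)%N -> x j = 0) -> (sval i).2 x = 0,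
     \sum_(i' <- h) `|(sval i').2 (v (sval i).1)| ^+ 2 <= d
     & d *+ 2 <= `|(sval i).2 (v (sval i).1)| ^+ 2]).
  have /cvg0P/(_ d d0)[N hN] :
      \sum_(i' <- h) `|(sval i').2 (v n)| ^+ 2 @[n --> \oo] --> (0 : K).
    elim: h => [|i h ih].
      by under eq_fun do rewrite big_nil; exact: cvg_cst.
    have hi : `|(sval i).2 (v n)| ^+ 2 @[n --> \oo] --> (0 : K).
      under eq_fun do rewrite -normrX.
      rewrite -(normr0 K); apply: cvg_norm.
      exact: bilinear_null_functional (svalP i).
    under eq_fun do rewrite big_cons; have := @cvgD K K^o _ \oo eventually_filter _ _ _ _ hi ih; rewrite addr0; exact.
  have [n] := hump (size h) (L h) (maxn N (size h)).
  rewrite geq_max => /andP[Nn hn] [psi [Gpsi bpsi psiL psid]].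
  exists (exist _ (n, psi) bpsi); split=> //=.
  apply: le_trans (ltW (hN _ Nn)); rewrite ger0_norm//.
  by apply: sumr_ge0 => i _; rewrite exprn_ge0.
pose n m := (sval (s m)).1; pose psi m := (sval (s m)).2.
have psib m : bounded_functional (psi m) := svalP (s m).
have nm m : (m <= n m)%N by have [] := hs m; rewrite size_mkseq.
have psi_later i m : (i < m)%N -> psi m (v (n i)) = 0.
  move=> im; have [_ _ + _ _] := hs m; apply=> j Lj; apply: hsb.
  apply: leq_trans Lj; rewrite leq_max; apply/orP; right.
  rewrite big_map; apply: (leq_bigmax_seq (F := fun i => sb (v (n i)))) => //.
  by rewrite mem_iota.
have psid m : d *+ 2 <= `|psi m (v (n m))| ^+ 2 by have [] := hs m.
have psin0 m : psi m (v (n m)) != 0.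
  apply: contraTneq (psid m) => ->; rewrite normr0 expr0n/=.
  by rewrite real_leNgt ?negbK ?real0 ?gtr0_real ?pmulrn_lgt0.
(* For [i < m], [psi m] vanishes at [v (n i)] while [psi i] does not. *)
have psi_inj : injective psi.
  move=> i m; wlog im : i m / (i < m)%N => [hw e|e].
    have [/hw h|/hw h|//] := ltngtP i m; [exact: h|exact/esym/h].
  by have := psin0 i; rewrite e psi_later// eqxx.
have psi0 m x : (sb x <= m)%N -> psi m x = 0.
  move=> xm; have [_ _ + _ _] := hs m; apply=> j; rewrite geq_max size_mkseq.
  by move=> /andP[mj _]; apply: hsb; exact: leq_trans mj.
have hb := hbound psi psi_inj (fun m => ltac:(by have [] := hs m; rewrite size_mkseq)).
(* The terms from [sb x] on vanish, so this is the whole series; [BE] allows any larger cut-off. *)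
pose B x y := \sum_(m < sb x) psi m x * psi m y.
have BE x y N : (sb x <= N)%N -> B x y = \sum_(m < N) psi m x * psi m y.
  move=> xN; rewrite -(big_mkord xpredT (fun m => psi m x * psi m y)).
  rewrite (big_cat_nat (leq0n _) xN)/= big_mkord [X in _ + X]big_nat [X in _ + X]big1 ?addr0//.
  by move=> i /andP[xi _]; rewrite psi0 ?mul0r.
have : B (v n) (v n) @[n --> \oo] --> 0.
  apply: (hv B M).
  - move=> y a x x' /=; pose N := maxn (sb (a *: x + x')) (maxn (sb x) (sb x')).
    rewrite !(BE _ _ N) ?leq_max ?leqnn ?orbT//.
    rewrite mulr_sumr -big_split; apply: eq_bigr => m _ /=.
    by rewrite (psib m).1; ring.
  - move=> x a y y' /=; rewrite /B mulr_sumr -big_split.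
    by apply: eq_bigr => m _ /=; rewrite (psib m).1; ring.
  - move=> x y; apply: le_trans (ler_norm_sum _ _ _) _.
    under eq_bigr do rewrite normrM.
    have psip0 m z : p z = 0 -> psi m z = 0.
      move=> z0; have [_ [C /(_ z)]] := psib m; rewrite z0 mulr0.
      by move=> hz; apply/eqP; rewrite -normr_le0.
    (* Zero norms are set apart, as [cauchy_schwarz_scaled] needs positive scaling factors. *)
    have [x0|xn0] := eqVneq (p x) 0.
      rewrite x0 mul0r mulr0 big1// => m _.
      by rewrite psip0// normr0 mul0r.
    have [y0|yn0] := eqVneq (p y) 0.
      rewrite y0 !mulr0 big1// => m _.
      by rewrite (psip0 _ y)// normr0 mulr0.
    apply: (@cauchy_schwarz_scaled _ (fun m => `|psi m x|) (fun m => `|psi m y|))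
      => //; rewrite ?lt_def ?xn0 ?yn0 ?schreier_norm_ge0//.
move=> /cvg0P/(_ d d0)[N hN].
have := hN (n N) (nm N); rewrite (_ : B _ _ =
    \sum_(m < N) psi m (v (n N)) ^+ 2 + psi N (v (n N)) ^+ 2); last first.
  rewrite (BE _ _ (maxn (sb (v (n N))) N.+1)) ?leq_maxl//.
  rewrite -(big_mkord xpredT (fun m => psi m (v (n N)) * psi m (v (n N)))).
  rewrite (@big_cat_nat _ _ _ N.+1) ?leq_maxr//= [X in _ + X]big_nat.
  rewrite [X in _ + X]big1 ?addr0 ?big_mkord ?big_ord_recr//=.
  by move=> i /andP[Ni _]; rewrite psi_later ?mul0r.
move=> hlt; have : d *+ 2 < d + d.
  apply: le_lt_trans (psid N) _; rewrite -normrX.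
  set b := psi N _ ^+ 2 in hlt *; set a := \sum_(m < N) _ in hlt.
  have -> : `|b| = `|(a + b) - a| by congr `|_|; ring.
  apply: le_lt_trans (ler_normB _ _) _; rewrite ltr_leD//.
  apply: le_trans (ler_norm_sum _ _ _) _.
  have [_ _ _ + _] := hs N; rewrite -/(n N) /mkseq big_map.
  rewrite -[N in iota 0 N]subn0 -/(index_iota 0 N) big_mkord.
  by apply: le_trans; apply: ler_sum => i _; rewrite normrX.
by rewrite mulr2n ltxx.
Qed.

(** Otherwise coordinates of size at least [e] occur for arbitrarily large [n], and beyond any [L]
    since the first [L] coordinates tend to 0. The hump runs on coordinate functionals, with the
    constant 8 of [schreier_norm_l2] and [2 d = e ^ 2]. *)
Lemma bilinear_null_sup v (e : K) : bilinear_null v -> 0 < e ->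
  exists N, forall n, (N <= n)%N -> forall j, `|v n j| < e.
Proof.
move=> hv e0; apply: contrapT => /forallNP h.
have {}h N : exists2 n, (N <= n)%N & exists j, e <= `|v n j|.
  apply: contrapT => hN; apply: (h N) => n Nn j.
  rewrite real_ltNge ?normr_real ?(gtr0_real e0)//; apply/negP => ej.
  by apply: hN; exists n => //; exists j.
apply: (@gliding_hump v (fun _ psi => exists j, psi = fun x => x j)
    (e ^+ 2 / 2) 8) => //.
- by rewrite divr_gt0// exprn_gt0.
- move=> psi psii hpsi N' x; have [J hJ] := choice hpsi.
  have Ji : injective J by move=> i1 i2 ij; apply: psii; rewrite !hJ ij.
  have uJ : uniq (map J (iota 0 N')) by rewrite map_inj_uniq ?iota_uniq.
  have := schreier_norm_l2 hK x uJ; rewrite big_map.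
  rewrite -[N' in iota 0 N']subn0 -/(index_iota 0 N') big_mkord.
  by under [X in _ -> X <= _]eq_bigr do rewrite hJ.
- move=> k L N; have [N' hN'] := bilinear_null_coord L hv e0.
  have [n] := h (maxn N N'); rewrite geq_max => /andP[Nn N'n] [j ej].
  exists n => //; exists (fun x => x j); split.
  + by exists j.
  + exact: bounded_functional_coord.
  + move=> x; apply; rewrite leqNgt; apply/negP => jL.
    by have := le_lt_trans ej (hN' n N'n j jL); rewrite ltxx.
  + rewrite -(mulr_natr (e ^+ 2 / 2)) divfK ?pnatr_eq0//.
    by rewrite ler_pXn2r ?nnegrE// ltW.
Qed.

(** Otherwise, at stage [k], some [v n] has norm above [2 ^ k + 1]; a functional of norm at most
    [2 ^- k], ignoring the coordinates below [L], still has value at least 1 there. *)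
Lemma bilinear_null_bounded v : bilinear_null v ->
  exists (C : K) (N : nat), forall n, (N <= n)%N -> p (v n) <= C.
Proof.
move=> hv; apply: contrapT => /forallNP h.
have {}h (C : K) N : 0 <= C -> exists2 n, (N <= n)%N &
    exists2 A : {fset nat}, admissible A & C < \sum_(j <- A) `|v n j|.
  move=> C0; apply: contrapT => hN; apply: (h C); exists N => n Nn.
  apply: (schreier_norm_sup hK _).2 => A aA.
  rewrite real_leNgt ?(ger0_real C0) ?ger0_real ?sumr_ge0//; apply/negP => CA.
  by apply: hN; exists n => //; exists A.
apply: (@gliding_hump v (fun k psi => forall x, `|psi x| <= 2 ^- k * p x)
    2^-1 2) => //.
- move=> psi _ hpsi N x.
  apply: (@le_trans _ _ (\sum_(m < N) 2 ^- m * p x ^+ 2)).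
    apply: ler_sum => m _; apply: le_trans (_ : (2 ^- m * p x) ^+ 2 <= _).
      by apply: lerXn2r; rewrite ?nnegrE ?mulr_ge0 ?schreier_norm_ge0.
    rewrite exprMn ler_wpM2r ?exprn_ge0 ?schreier_norm_ge0//.
    rewrite expr2 ler_piMr ?invr_ge0 ?exprn_ge0//.
    by rewrite invf_le1 ?exprn_gt0// exprn_ege1// ler1n.
  by rewrite -mulr_suml ler_wpM2r ?sum_exp2V// exprn_ge0// schreier_norm_ge0.
(* With each of the first [L] coordinates below [1 / (L + 1)], dropping them costs at most the 1
   added to [2 ^ k]. *)
- move=> k L N; have [N' hN'] := bilinear_null_coord L hv
    (ltac:(by rewrite invr_gt0 ltr0n) : 0 < L.+1%:R^-1 :> K).
  have [|n] := h (2 ^+ k + 1) (maxn N N'); first by rewrite addr_ge0// exprn_ge0.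
  rewrite geq_max => /andP[Nn N'n] [A aA hA].
  (* The conjugate sign of [v n j], which is 0 when [v n j = 0] since division by 0 gives 0. *)
  pose th j := `|v n j| / v n j.
  have th1 j : `|th j| <= 1.
    rewrite /th normrM normfV normr_id; have [->|v0] := eqVneq (v n j) 0.
      by rewrite normr0 mul0r.
    by rewrite divff// normr_eq0.
  have thE j : th j * v n j = `|v n j|.
    have [v0|v0] := eqVneq (v n j) 0; first by rewrite v0 mulr0 normr0.
    by rewrite /th divfK.
  pose psi x := 2 ^- k * \sum_(j <- A | (L <= j)%N) th j * x j.
  have psib x : `|psi x| <= 2 ^- k * p x.
    rewrite /psi normrM ger0_norm ?invr_ge0 ?exprn_ge0//.
    rewrite ler_wpM2l ?invr_ge0 ?exprn_ge0//.
    apply: le_trans ((schreier_norm_sup hK x).1 A aA).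
    apply: le_trans (ler_norm_sum _ _ _) _.
    rewrite [leRHS](bigID (fun j => (L <= j)%N)) /=.
    apply: le_trans (_ : \sum_(j <- A | (L <= j)%N) `|x j| <= _).
      by apply: ler_sum => j _; rewrite normrM ler_piMl.
    by rewrite lerDl sumr_ge0.
  exists n => //; exists psi; split=> //.
  + split; last by exists (2 ^- k).
    move=> a x y; rewrite /psi mulrCA -mulrDr; congr (_ * _).
    rewrite mulr_sumr -big_split /=; apply: eq_bigr => j _.
    by transitivity (th j * (a * x j + y j)); [|ring].
  + move=> x x0; rewrite /psi big1 ?mulr0// => j Lj.
    by rewrite x0// mulr0.
  + rewrite -(mulr_natr 2^-1) mulVf ?pnatr_eq0//.
    suff h1 : 1 <= psi (v n) by rewrite ger0_norm ?exprn_ege1// (le_trans _ h1).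
    rewrite /psi mulrC ler_pdivlMr ?exprn_gt0// mul1r.
    under eq_bigr do rewrite thE.
    rewrite (bigID (fun j => (L <= j)%N)) /= in hA.
    rewrite -(lerD2r 1); apply: le_trans (ltW hA) _; rewrite lerD2l.
    rewrite -big_filter; apply: (@le_trans _ _ (\sum_(j < L) `|v n j|)).
      apply: sum_uniq_le => [|//|i].
        by rewrite filter_uniq// fset_uniq.
      by rewrite mem_filter => /andP[/negP].
    apply: (@le_trans _ _ (\sum_(j < L) L.+1%:R^-1)).
      by apply: ler_sum => j _; rewrite ltW// hN'.
    rewrite sumr_const card_ord -[_ *+ L]mulr_natl ler_pdivrMr ?ltr0n// mul1r.
    by rewrite ler_nat.
Qed.

(** An admissible set meeting the support of an earlier term has so few elements that the sum of
    [v (f i)] over it is at most [2 ^- i]. Thus only the first term that the set meets can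
    contribute more, and at most [C]; the rest adds at most 2. *)
Lemma bilinear_null_subseq v : bilinear_null v ->
  exists2 f : nat -> nat, {homo f : m n / (m < n)%N} & exists C : K,
    forall s t, uniq (s ++ t) ->
      p (\sum_(i <- s) v (f i) - \sum_(i <- t) v (f i)) <= C.
Proof.
move=> hv; have [C [N0 hC]] := bilinear_null_bounded hv.
have [sb hsb] := choice (@c00_support K).
pose L (h : seq nat) := \max_(i <- h) sb (v i).
have [h N|f fi hf] := @subseq_choice (fun h n => (N0 <= n)%N /\
    forall j, (L h)%:R * `|v n j| <= 2 ^- size h).
  have [|N' hN'] := @bilinear_null_sup v (2 ^- size h / (L h).+1%:R) hv.
    by rewrite divr_gt0 ?invr_gt0 ?exprn_gt0.
  pose n := maxn N (maxn N0 N').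
  exists n; first by rewrite leq_maxl.
  split=> [|j]; first by rewrite !leq_max leqnn orbT.
  have /hN'/(_ j) : (N' <= n)%N by rewrite !leq_max leqnn !orbT.
  rewrite ltr_pdivlMr ?ltr0n// mulrC => /ltW; apply: le_trans.
  by rewrite ler_wpM2r// ler_nat.
exists f => //; exists (C + 2) => s t ust.
apply: (schreier_norm_sup hK _).2 => A aA.
pose a i := \sum_(j <- A) `|v (f i) j|.
have aC i : a i <= C.
  by apply: le_trans (hC _ (hf i).1); apply: (schreier_norm_sup hK _).1.
have a0 i : 0 <= a i by rewrite sumr_ge0.
have aP m i : (m < i)%N -> a m = 0 \/ a i <= 2 ^- i.
  move=> mi; have [am|/eqP am] := pselect (a m = 0); first by left.
  right; have [j jA vj] : exists2 j, j \in A & v (f m) j != 0.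
    apply: contrapT => hA; case/eqP: am; rewrite /a big_seq big1// => j jA.
    by apply/eqP; rewrite normr_eq0; apply: contrapT => /negP vj; apply: hA; exists j.
  have cA : (#|` A| <= L (mkseq f i))%N.
    (* Admissibility gives [j + 1] as a bound, and [j] in the support means [j < sb (v (f m))]: the
       index shift fits the strict inequality. *)
    apply: leq_trans (aA j jA) _; apply: leq_trans (_ : (sb (v (f m)) <= _)%N).
      by rewrite ltnNge; apply: contraNN vj => /hsb->.
    apply: (leq_bigmax_seq (F := fun i => sb (v i))) => //.
    by apply/mapP; exists m; rewrite ?mem_iota.
  have := (hf i).2; rewrite size_mkseq => hfi.
  have [A0|A0] := posnP (#|` A|).
    move: A0 => /cardfs0_eq A0; rewrite A0 in_fset0 in jA; by [].
  have Ap : 0 < #|` A|%:R :> K by rewrite ltr0n.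
  apply: (@le_trans _ _ (\sum_(j <- A) 2 ^- i / #|` A|%:R)).
    apply: ler_sum => l _; rewrite ler_pdivlMr// mulrC.
    by apply: le_trans (hfi l); rewrite ler_wpM2r// ler_nat.
  by rewrite big_const_seq count_predT iter_addr_0 -[_ *+ _]mulr_natr divfK// gt_eqF.
have C0 : 0 <= C by apply: le_trans (aC 0%N).
have sum_a M : \sum_(i < M) a i <= C + \sum_(i < M) 2 ^- i.
  elim: M => [|M ih]; first by rewrite !big_ord0 addr0.
  have [aM|/existsNP[m /not_implyP[mM am]]] :=
      pselect (forall m, (m < M)%N -> a m = 0).
    rewrite big_ord_recr /= big1 ?add0r; last by move=> i _; exact: aM.
    by apply: le_trans (aC M) _; rewrite lerDl sumr_ge0// => i _; rewrite invr_ge0 exprn_ge0.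
  rewrite !big_ord_recr /= addrA lerD//.
  by have [] := aP _ _ mM.
apply: (@le_trans _ _ (\sum_(i <- s ++ t) a i)).
  rewrite /a exchange_big /=; apply: ler_sum => j _.
  rewrite (_ : (_ - _) j = \sum_(i <- s) v (f i) j - \sum_(i <- t) v (f i) j).
    rewrite big_cat /=; apply: le_trans (ler_normB _ _) _.
    by rewrite lerD// ler_norm_sum.
  by rewrite -!c00_sum.
apply: (@le_trans _ _ (\sum_(i < (\max_(i <- s ++ t) i).+1) a i)).
  apply: sum_uniq_le => // i ist; rewrite ltnNge; apply: contraNeq => _.
  exact: (leq_bigmax_seq (F := id)).
by apply: le_trans (sum_a _) _; rewrite lerD2l sum_exp2V.
Qed.

End bilinear_null.

(** * Return to the completion, and the theorem *)

Lemma P_null_comp (K : numFieldType) (E : normedModType K) (x : nat -> E)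
    (f : nat -> nat) :
  {homo f : m n / (m < n)%N} -> P_null x -> P_null (x \o f).
Proof. by move=> hf hx k P k0 /(hx k P k0); exact: cvg_comp (homo_ltn_cvg hf). Qed.

(** The bound is found on approximants in c00; the errors, at most [2 ^- i] at distinct indices [i],
    add at most 2. *)
Lemma schreier_P_null_subseq (K : numFieldType) (S : normedModType K)
    (j : {linear c00 K -> S}) (x : nat -> S) :
  scalar_like K -> (forall v, `|j v| = schreier_norm v) -> dense (range j) ->
  P_null x ->
  exists2 f : nat -> nat, {homo f : m n / (m < n)%N} &
    exists C, bounded_signed_sums (x \o f) C.
Proof.
move=> hK jn jd /(P_null_approx hK jd)[v xv hv].
have vnull : bilinear_null v.
  by move=> B M Bl Br Bb; apply: (hv B M) => // u w; rewrite !jn.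
have [f fi [C hC]] := bilinear_null_subseq hK vnull.
exists f => //; exists (C + 2) => s t ust.
pose d i := x (f i) - j (v (f i)).
have -> : \sum_(i <- s) (x \o f) i - \sum_(i <- t) (x \o f) i =
    j (\sum_(i <- s) v (f i) - \sum_(i <- t) v (f i)) +
    (\sum_(i <- s) d i - \sum_(i <- t) d i).
  rewrite /d linearB !(raddf_sum j) /= !sumrB.
  move: (\sum_(i <- s) _) (\sum_(i <- t) _) (\sum_(i <- s) _) (\sum_(i <- t) _).
  by move=> c e a b; rewrite opprB addrA [c - e + _]addrC !addrA !subrK.
apply: le_trans (ler_normD _ _) _; rewrite jn lerD ?hC//.
apply: le_trans (ler_normB _ _) _.
apply: (@le_trans _ _ (\sum_(i <- s ++ t) `|d i|)).
  by rewrite big_cat lerD//= ler_norm_sum.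
apply: (@le_trans _ _ (\sum_(i <- map f (s ++ t)) 2 ^- i)).
  by rewrite big_map; apply: ler_sum => i _; exact: xv.
apply: le_trans (sum_exp2V K (\max_(i <- map f (s ++ t)) i).+1).
apply: sum_uniq_le => [|i|i ist].
- by rewrite map_inj_uniq//; exact: homo_ltn_inj.
- by rewrite invr_ge0 exprn_ge0.
- by rewrite ltnNge; apply: contraNeq => _; exact: (leq_bigmax_seq (F := id)).
Qed.

Theorem proposition20 (R : realType) (K : numFieldType)
  (hK : K = (R : numFieldType) \/ K = (R[i] : numFieldType))
  (S : completeNormedModType K) (jS : {linear c00 K -> S})
  (hS : is_completion (@schreier_norm K) jS)
  (SS : lmodType K) (tau : {bilinear S -> S -> SS})
  (hSS : is_tensor_product tau)
  (T : completeNormedModType K) (jT : {linear SS -> T})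
  (hT : is_completion (projective_norm tau) jT)
  (x y : nat -> S) (hx : P_null x) (hy : P_null y) :
  Banach_Saks_set (range (fun n => jT (tau (x n) (y n)))) /\
  P_null (fun n => jT (tau (x n) (y n))).
Proof.
have hK' : scalar_like K.
  by case: hK => ->; [exact: scalar_like_real|exact: scalar_like_complex].
pose z n := jT (tau (x n) (y n)).
(* The subsequence for [y] is extracted from the one for [x], whose signed sums stay bounded. *)
have z_subseq (g : nat -> nat) : {homo g : m n / (m < n)%N} ->
    exists2 f : nat -> nat, {homo f : m n / (m < n)%N} &
      exists C, bounded_sums (z \o g \o f) C.
  move=> gi; have [jn jd] := hS.
  have [f fi [C hC]] := schreier_P_null_subseq hK' jn jd (P_null_comp gi hx).
  have gfi : {homo g \o f : m n / (m < n)%N} by move=> m n /fi/gi.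
  have [h hi [D hD]] := schreier_P_null_subseq hK' jn jd (P_null_comp gfi hy).
  exists (f \o h) => [m n /hi/fi//|]; exists (C * D).
  have hCh := bounded_signed_sums_comp (homo_ltn_inj hi) hC.
  apply: (bounded_sums_tensor _ hCh hD) => u v.
  by rewrite hT.1 projective_norm_le.
split=> [u uz|].
  have /choice[k hk] n : exists m, u n = z m.
    by have [m _ <-] := uz n; exists m.
  (* Either one index recurs for ever and gives a constant subsequence, or the indices tend to
     infinity and some subsequence of [u] is a subsequence of [z]. *)
  have [[m hm]|hinf] := pselect (exists m, forall N, exists2 n, (N <= n)%N & k n = m).
    have [f fi fm] := frequently_subseq hm; exists f => //; exists (z m).
    under eq_fun do under eq_bigr do rewrite hk fm.
    under eq_fun do rewrite sumr_const card_ord -[z m *+ _]scaler_nat scalerA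
      mulVf ?pnatr_eq0// scale1r.
    exact: cvg_cst.
  have [h N|f fi hf] := @subseq_choice (fun h n =>
      forall i, i \in h -> (k i < k n)%N).
    have leave B : exists M, forall n, (M <= n)%N -> (B <= k n)%N.
      elim: B => [|B [M hM]]; first by exists 0%N.
      have [M' hM'] : exists M', forall n, (M' <= n)%N -> k n != B.
        apply: contrapT => /forallNP h1; apply: hinf; exists B => N'.
        apply: contrapT => h2; apply: (h1 N') => n N'n.
        by apply/eqP => kn; apply: h2; exists n.
      exists (maxn M M') => n; rewrite geq_max => /andP[Mn M'n].
      by rewrite ltn_neqAle eq_sym hM'// hM.
    have [M hM] := leave (\max_(i <- h) k i).+1.
    exists (maxn N M); first exact: leq_maxl.
    move=> i ih; apply: leq_trans (hM _ (leq_maxr _ _)); rewrite ltnS.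
    exact: (leq_bigmax_seq (F := k)).
  have kfi : {homo k \o f : m n / (m < n)%N}.
    by move=> m n mn; apply: hf; apply/mapP; exists m; rewrite ?mem_iota.
  have [h hi [C hC]] := z_subseq _ kfi.
  exists (f \o h) => [m n /hi/fi//|]; exists 0.
  under eq_fun do under eq_bigr do rewrite hk.
  exact: bounded_sums_mean hK' hC.
(* Otherwise [|P|] stays at least [e] along a subsequence, yet a further one has bounded sums and
   makes [P] tend to 0. *)
move=> k P k0 Pk; apply: contrapT => /not_cvg0P[e e0 /frequently_subseq[g gi ge]].
have [f fi [C hC]] := z_subseq g gi.
have /cvg0P/(_ e e0)[N hN] := bounded_sums_polynomial hK' hC k0 Pk.
by have := lt_le_trans (hN N (leqnn _)) (ge (f N)); rewrite ltxx.
Qed.
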